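(* In the setting described in the context (selected gap $FT$ of a nonconvex standard polygonal escape minimizer $\gamma$ with hull $H$, with a left-anchor contact $Z_2$), if $Z_2\prec F\prec M$, then there is a left delimiter gap $WX$, that is, a gap of $\gamma$ with endpoints adjacent hull vertices $W,X$, whose outward normal lies in the closed normal-fan interval between $\zeta_L=(-\rho,\kappa)$ and $(0,1)$ and whose endpoints satisfy $$W\prec F\prec X\prec T.$$
   Context: Put $\rho=\frac{301804}{625565}$, $\kappa=\frac{547947}{625565}$, $D=\frac{82074390584}{84861020075}$, and let $\mathcal K=\operatorname{conv}\{(-c,0),(c,0),(0,s)\}$ with $s=766/\sqrt{625565}$, $c=197/\sqrt{625565}$. A path is an escape path if no translated and rotated copy of it lies in the interior of $\mathcal K$. A polygonal path is standard if it is simple and its nonrepeated vertices are exactly the extreme vertices of its convex hull, each visited once; a hull edge not traversed by the path is a gap; a standard path is convex if its links follow one hull-boundary chain between its endpoints, nonconvex otherwise. $X\prec Y$ means $X$ is visited strictly before $Y$. Setting: $\gamma$ is a nonconvex standard polygonal escape path, length-minimal among polygonal escape paths with at most $N$ segments for some $N$, of length $L<D$. Its selected gap is a gap $FT$ with a hull vertex $M$ and $h>0$ such that, in suitable rigid coordinates, the hull $H=\operatorname{conv}\gamma$ lies in the strip $0\le y\le h$ (both boundary lines supporting it), $F=(x_F,0)$, $T=(x_T,0)$, $M=(x_M,h)$, $x_F\le x_T$, $F\prec M\prec T$, and $L\ge(1+\sqrt2)h$. A contact of a direction $v$ is a vertex of $H$ maximizing $x\cdot v$ over $H$; a left-anchor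 contact $Z_2$ is a contact of $\zeta_L=(-\rho,\kappa)$. *)

(* Defs.v *)
From mathcomp Require Import all_boot all_order all_algebra.
From mathcomp Require Import all_classical all_reals all_analysis.
Set Implicit Arguments.
Unset Strict Implicit.
Unset Printing Implicit Defensive.
Import Order.TTheory GRing.Theory Num.Theory numFieldNormedType.Exports.
Local Open Scope classical_set_scope.
Local Open Scope ring_scope.

(* Integers are written in base 1000: ring numerals are unary, so the literal
   625565 would be a term with 625565 successors. *)
Definition n625565 {R : realType} : R := 625 * 10 ^+ 3 + 565.

Definition rho {R : realType} : R := (301 * 10 ^+ 3 + 804) / n625565.

Definition kappa {R : realType} : R := (547 * 10 ^+ 3 + 947) / n625565.

Definition Dlen {R : realType} : R :=
  (82 * 10 ^+ 9 + 74 * 10 ^+ 6 + 390 * 10 ^+ 3 + 584) /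
  (84 * 10 ^+ 9 + 861 * 10 ^+ 6 + 20 * 10 ^+ 3 + 75).

Definition zetaL {R : realType} : R * R := (- rho, kappa).

Section Plane.
Context {R : realType}.
Implicit Types (p q u v n z : R * R) (A : set (R * R)).

Definition dot u v : R := u.1 * v.1 + u.2 * v.2.

(* The library norm on R * R is the maximum norm. *)
Definition edist p q : R :=
  Num.sqrt ((p.1 - q.1) ^+ 2 + (p.2 - q.2) ^+ 2).

Definition conv_hull A : set (R * R) :=
  smallest (@convex_set R (R * R)%type) A.

Definition extreme_point A z : Prop :=
  A z /\ forall p q (t : R), A p -> A q -> 0 < t < 1 ->
           z = t *: p + (1 - t) *: q -> p = q.

Definition segment p q : set (R * R) :=
  [set z | exists2 t : R, 0 <= t <= 1 & z = (1 - t) *: p + t *: q].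

(* The rotation by the angle th followed by the translation by v. *)
Definition rigid (th : R) v p : R * R :=
  (cos th * p.1 - sin th * p.2 + v.1, sin th * p.1 + cos th * p.2 + v.2).

Definition tri_c : R := 197 / Num.sqrt n625565.
Definition tri_s : R := 766 / Num.sqrt n625565.

Definition triangle : set (R * R) :=
  conv_hull [set z | z \in [:: (- tri_c, 0); (tri_c, 0); (0, tri_s)]].

End Plane.

(* A polygonal path is given by the list of its successive vertices. *)
Section Path.
Context {R : realType}.
Implicit Types (g : seq (R * R)) (P Q n v z : R * R).

Definition vtx g (i : nat) : R * R := nth 0 g i.

Definition nlinks g : nat := (size g).-1.

Definition link g (i : nat) : set (R * R) := segment (vtx g i) (vtx g i.+1).

(* The first disjunct matters only for a one-point path. *)
Definition trace g : set (R * R) :=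
  [set z | z \in g \/ exists2 i, (i < nlinks g)%N & link g i z].

Definition plength g : R :=
  \sum_(i < nlinks g) edist (vtx g i) (vtx g i.+1).

Definition hull g : set (R * R) := conv_hull (trace g).

Definition hull_vertex g z : Prop := extreme_point (hull g) z.

Definition escape g : Prop :=
  forall (th : R) v, ~ (rigid th v @` trace g `<=` interior triangle).

Definition escape_minimizer g : Prop :=
  exists N : nat,
    [/\ (nlinks g <= N)%N, escape g &
        forall g', (nlinks g' <= N)%N -> escape g' -> plength g <= plength g'].

Definition simple_path g : Prop :=
  (forall i, (i < nlinks g)%N -> vtx g i != vtx g i.+1) /\
  (forall i j z, (i < j)%N -> (j < nlinks g)%N -> link g i z -> link g j z ->
     j = i.+1 /\ z = vtx g j).

Definition standard g : Prop :=
  [/\ simple_path g, uniq g & forall z, z \in g <-> hull_vertex g z].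

(* P and Q are the two endpoints of an edge of the hull (adjacent hull
   vertices) with outward normal n, not necessarily of unit length. *)
Definition hull_edge_normal g P Q n : Prop :=
  [/\ hull_vertex g P, hull_vertex g Q & P != Q] /\
  [/\ n != 0, dot P n = dot Q n & forall z, hull g z -> dot z n <= dot P n].

Definition hull_edge g P Q : Prop := exists n, hull_edge_normal g P Q n.

Definition traversed g P Q : Prop :=
  exists2 i, (i < nlinks g)%N &
    (vtx g i = P /\ vtx g i.+1 = Q) \/ (vtx g i = Q /\ vtx g i.+1 = P).

Definition gap g P Q : Prop := hull_edge g P Q /\ ~ traversed g P Q.

(* The vertices of a standard path are distinct, so successive links that are
   hull edges cannot turn back: they form a single boundary chain. *)
Definition convex_path g : Prop :=
  standard g /\
  forall i, (i < nlinks g)%N -> hull_edge g (vtx g i) (vtx g i.+1).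

Definition nonconvex_path g : Prop := standard g /\ ~ convex_path g.

Definition prec g P Q : bool :=
  [&& P \in g, Q \in g & (index P g < index Q g)%N].

Definition contact g v z : Prop :=
  hull_vertex g z /\ forall w, hull g w -> dot w v <= dot z v.

(* The path is placed in the rigid coordinates of the selected gap FT. *)
Definition selected_gap g F T M (h : R) : Prop :=
  [/\ gap g F T, hull_vertex g M & 0 < h] /\
  [/\ forall z, hull g z -> 0 <= z.2 <= h,
      [/\ F.2 = 0, T.2 = 0 & M.2 = h],
      F.1 <= T.1,
      prec g F M && prec g M T &
      (1 + Num.sqrt 2) * h <= plength g].

(* The directions in the closed angular sector spanned by u and v; it is the
   fan interval between them when u and v are not opposite. *)
Definition fan_interval (u v n : R * R) : Prop :=
  n != 0 /\ exists a b : R, [/\ 0 <= a, 0 <= b & n = a *: u + b *: v].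

Definition left_delimiter_gap g W X : Prop :=
  gap g W X /\
  exists2 n, hull_edge_normal g W X n & fan_interval zetaL (0, 1) n.

End Path.

(* Main.v *)
Require Import Defs.
From mathcomp Require Import all_boot all_order all_algebra.
From mathcomp Require Import all_classical all_reals all_analysis.
From mathcomp Require Import ring lra.
Import Order.TTheory GRing.Theory Num.Theory numFieldNormedType.Exports.
Local Open Scope classical_set_scope.
Local Open Scope ring_scope.

(** Every vertex of the path precedes F, is F, or follows F. Turn a direction
from zeta_L to (0,1) and watch which of the two groups, before F or after F,
supports the hull. At zeta_L the early group does, through Z2; at (0,1) the
late group does, through M. The support values of the two groups vary
continuously, so they agree at some direction n in between
([envelopes_meet]). The vertex F itself never exceeds the early group: it is
no better than Z2 at zeta_L, which Z2 maximizes, and no better at (0,1), since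
F lies on the bottom line of the strip. Hence an early vertex W and a late
vertex X both maximize n over the hull ([edge_across]): they span a hull edge
with normal n. It is a gap because the path visits F between W and X
([prec_not_traversed]).

It remains to see that X precedes T. The point T lies right of F on the bottom
line, so no direction between zeta_L and (0,1) is maximized at T, and X is not
T. Suppose that X comes after T. If n is vertical, then W, X and M are three
distinct extreme points on the top line, which is absurd. Otherwise X, as a
maximizer of n, lies on the left of the line FM, while T lies on its right. So
the part of the path from T to X changes sides of the line FM, along some link
uv. By convex position, F and M then lie on different sides of the line uv, so
the part of the path from F to M has a link that changes sides of the line uv,
and this link meets uv. These links are not consecutive, contrary to
simplicity ([later_vertices_same_side]).

The argument applies to every simple path through the extreme points of its
hull and to every left-upward direction in place of zeta_L
([left_gap_between_F_and_T]). *)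

(** * Signs of the anchor direction *)

Section Directions.
Context {R : realType}.

(** Left to conversion, a positivity test on the unary numerals in rho and kappa
would unfold them; here the digit groups are variables. *)
Lemma base1000_gt0 (a k b : nat) : (0 < a)%N -> 0 < a%:R * 10 ^+ k + b%:R :> R.
Proof.
by move=> a0; rewrite ltr_wpDr ?ler0n // mulr_gt0 ?exprn_gt0 // ltr0n.
Qed.

Lemma rho_gt0 : 0 < rho :> R.
Proof. by apply: divr_gt0; apply: base1000_gt0. Qed.

Lemma kappa_gt0 : 0 < kappa :> R.
Proof. by apply: divr_gt0; apply: base1000_gt0. Qed.

End Directions.

(** * Families of functions on a line *)

Section UpperEnvelope.
Context {R : realType} {T : eqType}.
Variable f : T -> R -> R.
Hypothesis f_cont : forall z, continuous (f z).

Lemma upper_envelope (a : T) (s : seq T) :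
  exists2 m : R -> R, continuous m &
    forall t, (exists2 z, z \in a :: s & m t = f z t) /\
              (forall z, z \in a :: s -> f z t <= m t).
Proof.
elim: s => [|b s [m m_cont m_max]].
  exists (f a) => // t; split; first by exists a; rewrite ?mem_head.
  by move=> z; rewrite inE => /eqP ->.
exists (m \max f b).
  by move=> t; apply: continuous_max; [exact: m_cont|exact: f_cont].
move=> t; have [[z zs mz] mle] := m_max t; split.
  have [le_mb|lt_bm] := leP (m t) (f b t).
    by exists b; rewrite ?inE ?eqxx ?orbT //= max_r.
  exists z; last by rewrite /= max_l // ltW.
  by move: zs; rewrite !inE => /orP[->|->]; rewrite ?orbT.
move=> y; rewrite !inE le_max => /or3P[/eqP->|/eqP->|ys].
- by rewrite mle ?mem_head.
- by rewrite lexx orbT.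
- by rewrite mle // inE ys orbT.
Qed.

(** The intermediate value theorem for the difference of the two upper
envelopes, positive or zero at 0 and negative or zero at 1. *)
Lemma envelopes_meet (A B : seq T) (a b : T) :
    a \in A -> b \in B ->
    (forall z, z \in B -> f z 0 <= f a 0) ->
    (forall z, z \in A -> f z 1 <= f b 1) ->
  exists t w x, [/\ 0 <= t <= 1, w \in A, x \in B, f w t = f x t &
    forall z, z \in A ++ B -> f z t <= f w t].
Proof.
case: A B => [//|a0 A] [//|b0 B] aA bB a_max b_max.
have [mA mA_cont mA_max] := upper_envelope a0 A.
have [mB mB_cont mB_max] := upper_envelope b0 B.
have m0 : mB 0 <= mA 0.
  have [[z zB ->] _] := mB_max 0.
  by apply: le_trans (a_max z zB) _; apply: (mA_max 0).2.
have m1 : mA 1 <= mB 1.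
  have [[z zA ->] _] := mA_max 1.
  by apply: le_trans (b_max z zA) _; apply: (mB_max 1).2.
pose d t := mA t - mB t.
have d_cont : continuous d.
  by move=> t; apply: cvgB; [exact: mA_cont|exact: mB_cont].
have [||t t01 dt] := @IVT R d 0 1 0 ler01.
- exact: continuous_subspaceT.
- by rewrite ge_min le_max /d !subr_ge0 !subr_le0 m0 m1 orbT.
have mAB : mA t = mB t by apply/eqP; rewrite -subr_eq0; apply/eqP.
have [[w wA mw] lew] := mA_max t; have [[x xB mx] lex] := mB_max t.
exists t, w, x; split => //; first by rewrite -mw -mx.
by move=> z; rewrite mem_cat -mw => /orP[/lew//|/lex]; rewrite -mAB.
Qed.

End UpperEnvelope.

(** A discrete intermediate value theorem. Below it is applied to the sides of a
line that contains none of the vertices visited from step i to step j. *)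
Lemma sign_change {R : realType} (f : nat -> R) (i j : nat) :
    (i <= j)%N -> (forall k, (i <= k <= j)%N -> f k != 0) -> f i * f j < 0 ->
  exists2 k, (i <= k < j)%N & f k * f k.+1 < 0.
Proof.
elim: j => [|j IH].
  by rewrite leqn0 => /eqP -> _; rewrite -expr2 ltNge sqr_ge0.
rewrite leq_eqVlt => /orP[/eqP->|lt_ij] f_neq0 fij.
  by move: fij; rewrite -expr2 ltNge sqr_ge0.
have [fjj|fjj] := ltP (f j * f j.+1) 0.
  by exists j => //; rewrite -ltnS lt_ij ltnSn.
have fj0 : f j != 0 by apply: f_neq0; rewrite leqnSn andbT.
have fj1 : f j.+1 != 0 by apply: f_neq0; rewrite leqnn ltnW.
have fj_gt0 : 0 < f j * f j.+1 by rewrite lt_neqAle fjj eq_sym mulf_neq0.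
have [|||k /andP[ik kj] fk] := IH.
- by [].
- by move=> k /andP[ik kj]; apply: f_neq0; rewrite ik leqW.
- have : f i * f j * (f j.+1 ^+ 2) < 0.
    rewrite (_ : _ * _ = (f i * f j.+1) * (f j * f j.+1)); last by ring.
    by rewrite nmulr_rlt0.
  by rewrite pmulr_llt0 // lt_neqAle eq_sym sqrf_eq0 fj1 sqr_ge0.
by exists k => //; rewrite ik leqW.
Qed.

(** * Points of the plane in convex position *)

Section Orientation.
Context {R : realType}.
Implicit Types (a b c u v p q z : R * R) (g : seq (R * R)).

(** Twice the signed area of the triangle abc: positive when c lies on the left
of the line directed from a to b, zero when c lies on it. *)
Definition orient a b c : R :=
  (b.1 - a.1) * (c.2 - a.2) - (b.2 - a.2) * (c.1 - a.1).

Lemma pair_eq p q : p.1 = q.1 -> p.2 = q.2 -> p = q.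
Proof. by case: p q => [? ?] [? ?] /= -> ->. Qed.

Lemma orient_on_line a b c :
  a != b -> orient a b c = 0 -> exists s : R, c = (1 - s) *: a + s *: b.
Proof.
case: a b c => [a1 a2] [b1 b2] [c1 c2]; rewrite /orient xpair_eqE /= => ab abc.
have [e1|n1] := eqVneq b1 a1.
  have n2 : b2 - a2 != 0 by rewrite subr_eq0 eq_sym; move: ab; rewrite e1 eqxx.
  exists ((c2 - a2) / (b2 - a2)); rewrite e1.
  have -> : c1 = a1.
    move: abc; rewrite e1 subrr mul0r sub0r => /eqP.
    by rewrite oppr_eq0 mulf_eq0 (negPf n2) subr_eq0 => /eqP.
  apply: pair_eq; rewrite /= /GRing.scale /=; first by ring.
  by field.
have {}n1 : b1 - a1 != 0 by rewrite subr_eq0.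
exists ((c1 - a1) / (b1 - a1)).
apply: pair_eq; rewrite /= /GRing.scale /=; first by field.
apply: (mulfI n1).
have -> : (b1 - a1) * c2 = (b2 - a2) * (c1 - a1) + (b1 - a1) * a2 by lra.
by field.
Qed.

Lemma hull_convex g p q (t : R) : hull g p -> hull g q -> 0 <= t <= 1 ->
  hull g (t *: p + (1 - t) *: q).
Proof.
move=> hp hq /andP[t0 t1] A [A_conv gA].
have := A_conv p q (Itv01 t0 t1); rewrite !inE; apply.
  by apply: hp; split.
by apply: hq; split.
Qed.

Lemma hull_halfplane g n (e : R) :
  (forall z, z \in g -> dot z n <= e) -> forall z, hull g z -> dot z n <= e.
Proof.
move=> le_g; apply: smallest_sub.
  move=> p q l; rewrite !inE /= => hp hq.
  have l0 : 0 <= l%:num by [].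
  have l1 : l%:num <= 1 by [].
  rewrite -[conv l p q]/(l%:num *: (p : R * R) + (1 - l%:num) *: (q : R * R)).
  have -> : dot (l%:num *: (p : R * R) + (1 - l%:num) *: (q : R * R)) n =
            l%:num * dot p n + (1 - l%:num) * dot q n.
    by rewrite /dot /= /GRing.scale /=; ring.
  have := ler_wpM2l l0 hp.
  have l1' : 0 <= 1 - l%:num by rewrite subr_ge0.
  have := ler_wpM2l l1' hq; lra.
move=> z [/le_g//|[i ig [t /andP[t0 t1] ->]]].
have ig1 : (i.+1 < size g)%N by move: ig; rewrite /nlinks; case: (size g).
have h0 := le_g _ (mem_nth 0 (ltnW ig1)).
have h1 := le_g _ (mem_nth 0 ig1).
have -> : dot ((1 - t) *: vtx g i + t *: vtx g i.+1) n =
    (1 - t) * dot (vtx g i) n + t * dot (vtx g i.+1) n.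
  by rewrite /dot /= /GRing.scale /=; ring.
have := ler_wpM2l t0 h1.
have t1' : 0 <= 1 - t by rewrite subr_ge0.
have := ler_wpM2l t1' h0; rewrite /vtx; lra.
Qed.

(** If s exceeded 1, the extreme point b would lie strictly between the points a
and z of A. *)
Lemma extreme_line_param (A : set (R * R)) a z (s : R) b : extreme_point A b ->
  A a -> A z -> z = (1 - s) *: a + s *: b -> a != b -> s <= 1.
Proof.
move=> [_ b_ext] Aa Az zE ab; rewrite leNgt; apply/negP => s1.
have s0 : 0 < s by lra.
have sn0 : s != 0 by rewrite gt_eqF.
have az : z = a.
  apply: (b_ext _ _ s^-1) => //; first by rewrite invr_gt0 s0 invf_lt1.
  rewrite zE; case: a b {zE ab b_ext Aa Az} => [a1 a2] [b1 b2].
  by apply: pair_eq; rewrite /= /GRing.scale /=; field.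
move/eqP: ab; apply; move: zE; rewrite az.
case: a b {b_ext Aa Az az} => [a1 a2] [b1 b2] [e1 e2].
have sn : s != 0 by [].
by apply: pair_eq; apply: (mulfI sn); move: e1 e2; rewrite /GRing.scale /=; lra.
Qed.

(** Of three collinear points one lies between the other two, hence is not
extreme. *)
Lemma extreme_noncollinear g a b c :
    hull_vertex g a -> hull_vertex g b -> hull_vertex g c ->
    a != b -> c != a -> c != b ->
  orient a b c != 0.
Proof.
move=> ha hb hc ab ca cb; apply/eqP => /(orient_on_line a b c ab)[s cE].
have Ha := ha.1; have Hb := hb.1; have Hc := hc.1.
have s1 : s <= 1 by apply: (extreme_line_param _ _ _ _ _ hb Ha Hc cE).
have s0 : 1 - s <= 1.
  apply: (extreme_line_param _ _ _ _ _ ha Hb Hc); last by rewrite eq_sym.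
  by rewrite cE subKr addrC.
have sn0 : s != 0.
  by apply: contraNneq ca => s_0; rewrite cE s_0 subr0 scale1r scale0r addr0.
have sn1 : s != 1.
  by apply: contraNneq cb => s_1; rewrite cE s_1 subrr scale1r scale0r add0r.
move/eqP: ab; apply; apply: (hc.2 a b (1 - s)) => //; last by rewrite subKr.
have : 0 < s by rewrite lt_neqAle eq_sym sn0; lra.
have : s < 1 by rewrite lt_neqAle sn1.
lra.
Qed.

(** The segment uv meets the line ab at a point z of the hull. That point lies
between a and b: outside, it would make a or b an inner point of a segment of
the hull, and it is neither a nor b, since these are not inner points of uv. *)
Lemma chords_cross g a b u v :
    hull_vertex g a -> hull_vertex g b -> hull_vertex g u -> hull_vertex g v ->
    a != b -> orient a b u * orient a b v < 0 ->
  exists r s : R, [/\ 0 < r < 1, 0 < s < 1 &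
    (1 - r) *: u + r *: v = (1 - s) *: a + s *: b].
Proof.
move=> ha hb hu hv ab ouv.
pose ou := orient a b u; pose ov := orient a b v.
have uv0 : ou - ov != 0.
  apply: contraTneq ouv => /eqP; rewrite subr_eq0 => /eqP; rewrite /ou => ->.
  by rewrite -leNgt -expr2 sqr_ge0.
(* The orientation is affine in the third point, which gives the parameter of
   the zero on uv. *)
pose r := ou / (ou - ov).
have r01 : 0 < r < 1.
  have {}ouv : ou * ov < 0 := ouv.
  rewrite /r; have [ou0|ou0|ou0] := ltgtP ou 0.
  - have ov0 : 0 < ov by rewrite -(nmulr_rlt0 _ ou0).
    have d0 : ou - ov < 0 by lra.
    by rewrite ltr_ndivlMr // ltr_ndivrMr //; lra.
  - have ov0 : ov < 0 by rewrite -(pmulr_rlt0 _ ou0).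
    have d0 : 0 < ou - ov by lra.
    by rewrite ltr_pdivlMr // ltr_pdivrMr //; lra.
  - by move: ouv; rewrite ou0 mul0r ltxx.
pose z := (1 - r) *: u + r *: v.
have uv : u != v by apply: contraNneq uv0 => e; rewrite /ou /ov e subrr.
have Hz : hull g z.
  rewrite /z addrC; apply: hull_convex; [exact: hv.1|exact: hu.1|].
  by case/andP: r01 => ? ?; rewrite !ltW.
have z_nvertex y : hull_vertex g y -> z != y.
  move=> hy; apply: contraNneq uv => zy; apply/eqP; apply: (hy.2 u v (1 - r)).
  - exact: hu.1.
  - exact: hv.1.
  - by lra.
  - by rewrite -zy subKr.
have oz : orient a b z = 0.
  have -> : orient a b z = (1 - r) * ou + r * ov.
    by rewrite /z /ou /ov /orient /= /GRing.scale /=; ring.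
  by rewrite /r; field.
have [s zE] := orient_on_line a b z ab oz.
have s1 : s <= 1 by apply: (extreme_line_param _ _ _ _ _ hb ha.1 Hz zE).
have s0 : 1 - s <= 1.
  apply: (extreme_line_param _ _ _ _ _ ha hb.1 Hz); last by rewrite eq_sym.
  by rewrite zE subKr addrC.
have sn0 : s != 0.
  apply: contraNneq (z_nvertex a ha) => s_0.
  by rewrite zE s_0 subr0 scale1r scale0r addr0.
have sn1 : s != 1.
  apply: contraNneq (z_nvertex b hb) => s_1.
  by rewrite zE s_1 subrr scale1r scale0r add0r.
exists r, s; split => //.
rewrite !lt_neqAle s1 sn1 eq_sym sn0 andbT /=; lra.
Qed.

(** The common point of the two chords is a proper convex combination of a and b,
and its orientation with respect to uv is 0. So the orientations of a and b
have opposite signs, as neither of them is 0. *)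
Lemma chords_separate_each_other g a b u v :
    hull_vertex g a -> hull_vertex g b -> hull_vertex g u -> hull_vertex g v ->
    a != b -> orient a b u * orient a b v < 0 ->
  orient u v a * orient u v b < 0.
Proof.
move=> ha hb hu hv ab ouv.
have [r [s [_ s01 zE]]] := chords_cross _ _ _ _ _ ha hb hu hv ab ouv.
have uv : u != v.
  by apply: contraTneq ouv => ->; rewrite -leNgt -expr2 sqr_ge0.
have au : a != u.
  apply: contraTneq ouv => <-; rewrite (_ : orient a b a = 0) ?mul0r ?ltxx //.
  by rewrite /orient; ring.
have av : a != v.
  apply: contraTneq ouv => <-.
  by rewrite (_ : orient a b a = 0) ?mulr0 ?ltxx // /orient; ring.
have na : orient u v a != 0 by apply: (extreme_noncollinear g).
have e : (1 - s) * orient u v a + s * orient u v b = 0.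
  have -> : (1 - s) * orient u v a + s * orient u v b =
            orient u v ((1 - s) *: a + s *: b).
    by rewrite /orient /= /GRing.scale /=; ring.
  by rewrite -zE /orient /= /GRing.scale /=; ring.
case/andP: s01 => s0 s1.
rewrite -(pmulr_rlt0 _ s0).
have -> : s * (orient u v a * orient u v b) =
          - ((1 - s) * orient u v a ^+ 2).
  rewrite mulrCA.
  have -> : s * orient u v b = - ((1 - s) * orient u v a) by lra.
  by ring.
by rewrite oppr_lt0 mulr_gt0 ?subr_gt0 // lt_neqAle sqr_ge0 eq_sym sqrf_eq0 na.
Qed.

(** A polygonal form of the Jordan curve argument: the part of the path from step
i1 to step i2 cuts the hull in two, and the part from i3 to i4 cannot cross it.
The discrete intermediate value theorem serves twice. A link of the later part
separates the points i1 and i2 (by the symmetry of separation), so a link of the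
earlier part changes sides of that link, and the two links cross. *)
Lemma later_vertices_same_side g (i1 i2 i3 i4 : nat) :
    standard g -> (i1 < i2)%N -> (i2 < i3)%N -> (i3 < i4)%N -> (i4 < size g)%N ->
  ~ orient (vtx g i1) (vtx g i2) (vtx g i3) *
    orient (vtx g i1) (vtx g i2) (vtx g i4) < 0.
Proof.
move=> [[_ g_simple] g_uniq g_hull] i12 i23 i34 i4g sep.
have hv k : (k < size g)%N -> hull_vertex g (vtx g k).
  by move=> kg; apply/g_hull; rewrite mem_nth.
have vneq k l : (k < l)%N -> (l < size g)%N -> vtx g k != vtx g l.
  by move=> kl lg; rewrite nth_uniq // ?ltn_eqF // (ltn_trans kl).
have i3g := ltn_trans i34 i4g; have i2g := ltn_trans i23 i3g.
have i1g := ltn_trans i12 i2g.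
have [|k|l /andP[il li] sepl] :=
  sign_change (fun k => orient (vtx g i1) (vtx g i2) (vtx g k)) i3 i4 _ _ sep.
- exact: ltnW.
- move=> /andP[ik ki]; have kg := leq_ltn_trans ki i4g.
  have i2k := leq_trans i23 ik.
  apply: (extreme_noncollinear g); do ?exact: hv; first exact: vneq.
    by rewrite eq_sym; apply: vneq => //; apply: ltn_trans i2k.
  by rewrite eq_sym; apply: vneq.
have lg := leq_ltn_trans li i4g; have lg' := ltnW lg.
have i2l := leq_trans i23 il.
have sep2 := chords_separate_each_other g _ _ _ _ (hv _ i1g) (hv _ i2g) (hv _ lg')
  (hv _ lg) (vneq _ _ i12 i2g) sepl.
have [|k|k /andP[ik ki] sepk] :=
  sign_change (fun k => orient (vtx g l) (vtx g l.+1) (vtx g k)) i1 i2 _ _ sep2.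
- exact: ltnW.
- move=> /andP[ik ki]; have kl := leq_ltn_trans ki i2l.
  apply: (extreme_noncollinear g); do ?exact: hv.
  - by apply: hv; apply: leq_ltn_trans ki i2g.
  - exact: vneq.
  - exact: vneq.
  - by apply: vneq => //; apply: leqW.
have kl := leq_ltn_trans ki i2l.
have kg := ltn_trans kl lg'.
have [r [s [/andP[r0 r1] /andP[s0 s1] zE]]] := chords_cross g _ _ _ _
  (hv _ lg') (hv _ lg) (hv _ (ltnW kg)) (hv _ kg) (vneq _ _ (ltnSn l) lg) sepk.
have lnl : (l < nlinks g)%N by rewrite /nlinks; case: (size g) lg.
have [||lk _] := g_simple k l ((1 - s) *: vtx g l + s *: vtx g l.+1) (ltnW kl) lnl.
- by exists r; rewrite ?zE // !ltW.
- by exists s; rewrite // !ltW.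
by move: kl; rewrite lk ltnn.
Qed.

(** * Hull edges that straddle a vertex of the path *)

Lemma prec_not_traversed g P Q Z : uniq g ->
  prec g P Z -> prec g Z Q -> ~ traversed g P Q.
Proof.
move=> g_uniq /and3P[Pg Zg PZ] /and3P[_ Qg ZQ] [i ig].
have ig1 : (i.+1 < size g)%N by move: ig; rewrite /nlinks; case: (size g).
have idx k : (k < size g)%N -> index (vtx g k) g = k.
  by move=> kg; rewrite index_uniq.
have PQ := leq_ltn_trans PZ ZQ.
case=> -[e1 e2]; move: PZ ZQ PQ; rewrite -e1 -e2 !idx ?(ltnW ig1) // => PZ ZQ PQ.
  by move: (leq_trans PZ ZQ); rewrite ltnn.
by move: (ltn_trans (ltnSn i.+1) PQ); rewrite -ltnS ltnNge leqW.
Qed.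

(** This replaces the walk along the boundary chain from Z to M: the direction
that turns from n0 to n1 stops when the vertices before F and those after F give
the same support value. The hypothesis on F and n1 ensures that F, which is in
neither group, stays below Z at all times. *)
Lemma edge_across g n0 n1 Z F M :
    standard g -> contact g n0 Z -> contact g n1 M ->
    prec g Z F -> prec g F M -> dot F n1 <= dot Z n1 ->
  exists t W X, [/\ 0 <= t <= 1, prec g W F, prec g F X,
    dot W ((1 - t) *: n0 + t *: n1) = dot X ((1 - t) *: n0 + t *: n1) &
    forall z, hull g z ->
      dot z ((1 - t) *: n0 + t *: n1) <= dot W ((1 - t) *: n0 + t *: n1)].
Proof.
move=> [_ g_uniq g_hull] [Z_vertex Z_max] [M_vertex M_max] ZF FM FZ1.
have Hg z : z \in g -> hull g z by move=> /g_hull[].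
pose f z t := dot z ((1 - t) *: n0 + t *: n1).
have fE z t : f z t = (1 - t) * dot z n0 + t * dot z n1.
  by rewrite /f /dot /= /GRing.scale /=; ring.
have f_cont z : continuous (f z).
  have -> : f z = (fun t => dot z n0 + t * (dot z n1 - dot z n0)).
    by apply/funext => t; rewrite fE; ring.
  move=> t; apply: cvgD; first exact: cvg_cst.
  by apply: cvgM; [exact: cvg_id|exact: cvg_cst].
have [Zg Fg _] := and3P ZF; have [_ Mg _] := and3P FM.
have [||z|z|t [W [X [t01]]]] := envelopes_meet f f_cont
  [seq z <- g | prec g z F] [seq z <- g | prec g F z] Z M.
- by rewrite mem_filter ZF.
- by rewrite mem_filter FM.
- rewrite mem_filter => /andP[_ zg]; rewrite !fE subr0 !mul1r !mul0r !addr0.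
  exact: Z_max (Hg _ zg).
- rewrite mem_filter => /andP[_ zg]; rewrite !fE subrr !mul1r !mul0r !add0r.
  exact: M_max (Hg _ zg).
rewrite !mem_filter => /andP[WF Wg] /andP[FX Xg] WX W_max.
exists t, W, X; split=> //; apply: hull_halfplane => z zg.
have [zF|Fz|zF] := ltngtP (index z g) (index F g).
- by apply: W_max; rewrite mem_cat mem_filter /prec zg Fg zF.
- by apply: W_max; rewrite mem_cat !mem_filter /prec zg Fg Fz orbT.
(* The case z = F, where Z is at least as good as F throughout. *)
have -> : z = F by rewrite -(nth_index 0 zg) zF nth_index.
apply: (le_trans (y := f Z t)); last first.
  by apply: W_max; rewrite mem_cat mem_filter ZF Zg.
rewrite -/(f F t) !fE; case/andP: t01 => t0 t1.
have t1' : 0 <= 1 - t by rewrite subr_ge0.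
by apply: lerD; apply: ler_wpM2l => //; apply: Z_max (Hg _ Fg).
Qed.

(** The normal of the edge WX has the form (- al, be) with 0 <= al and 0 < be.
That sign pattern excludes X = T and, if X came after T, would put X on the left
of the line FM, opposite to T. *)
Lemma left_gap_between_F_and_T g F T M Z (h r k : R) :
    standard g -> F != T -> hull_vertex g M -> 0 < h ->
    (forall z, hull g z -> 0 <= z.2 <= h) ->
    [/\ F.2 = 0, T.2 = 0 & M.2 = h] -> F.1 <= T.1 ->
    0 < r -> 0 < k -> contact g (- r, k) Z ->
    prec g Z F -> prec g F M -> prec g M T ->
  exists W X n, [/\ gap g W X, hull_edge_normal g W X n,
    fan_interval (- r, k) (0, 1) n & [&& prec g W F, prec g F X & prec g X T]].
Proof.
move=> g_std FT_neq M_vertex h_gt0 strip [Fy Ty My] FT_x r0 k0 Z_contact.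
move=> ZF FM MT.
have [_ g_uniq g_hull] := g_std.
have Hg z : z \in g -> hull g z by move=> /g_hull[].
have M_contact : contact g (0, 1) M.
  split=> // z /strip /andP[_ zh].
  by rewrite /dot /= !mulr0 !add0r !mulr1 My.
have FZ : dot F (0, 1) <= dot Z (0, 1).
  have /strip/andP[Zy _] := Z_contact.1.1.
  by rewrite /dot /= !mulr0 !add0r !mulr1 Fy.
have [t [W [X [/andP[t0 t1] WF FX WX W_max]]]] :=
  edge_across _ _ _ _ _ _ g_std Z_contact M_contact ZF FM FZ.
exists W, X; set n := (1 - t) *: (- r, k) + t *: (0, 1) in WX W_max.
have [Wg Fg W_lt_F] := and3P WF; have [_ Xg F_lt_X] := and3P FX.
have [_ Mg F_lt_M] := and3P FM; have [_ Tg M_lt_T] := and3P MT.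
have W_neq_X : W != X.
  by apply: contraTneq (ltn_trans W_lt_F F_lt_X) => ->; rewrite ltnn.
have t1' : 0 <= 1 - t by rewrite subr_ge0.
pose al := (1 - t) * r; pose be := (1 - t) * k + t.
have al_ge0 : 0 <= al by apply: mulr_ge0 t1' (ltW r0).
have be_gt0 : 0 < be.
  rewrite /be; have [->|t_neq0] := eqVneq t 0; first by rewrite subr0 mul1r addr0.
  by rewrite ltr_wpDl ?mulr_ge0 ?(ltW k0) // lt_neqAle eq_sym t_neq0.
have nE : n = (- al, be).
  by apply: pair_eq; rewrite /n /al /be /= /GRing.scale /=; ring.
have dotE z : dot z n = be * z.2 - al * z.1 by rewrite nE /dot /=; ring.
have X_max z : hull g z -> be * z.2 - al * z.1 <= be * X.2 - al * X.1.
  by move=> /W_max; rewrite WX !dotE.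
have WX_edge : hull_edge_normal g W X n.
  split; first by split=> //; apply/g_hull.
  by split=> //; rewrite nE; apply/eqP => -[_ /eqP]; rewrite gt_eqF.
have FT1 : F.1 < T.1.
  rewrite lt_neqAle FT_x andbT.
  by apply: contraNneq FT_neq => e; apply/eqP/pair_eq; rewrite ?Fy.
have XT : prec g X T.
  rewrite /prec Xg Tg ltnNge; apply/negP; rewrite leq_eqVlt => /orP[/eqP TX|T_lt_X].
    (* F and M compete with T in the direction (- al, be): comparison with M
       gives 0 < al, and then F is strictly better. *)
    have {TX} TX : X = T by rewrite -(nth_index 0 Tg) TX nth_index.
    have := X_max _ (Hg _ Fg); have := X_max _ (Hg _ Mg).
    rewrite TX Fy Ty My !mulr0 !sub0r => le_M le_F.
    have be_h : 0 < be * h by rewrite mulr_gt0.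
    have al_gt0 : 0 < al.
      rewrite lt_neqAle al_ge0 andbT eq_sym.
      by apply/eqP => al0; move: le_M; rewrite al0 !mul0r; lra.
    by have := FT1; rewrite -(ltr_pM2l al_gt0); lra.
  have X_neq_M : X != M.
    by apply: contraTneq (ltn_trans M_lt_T T_lt_X) => ->; rewrite ltnn.
  have X_neq_F : X != F by apply: contraTneq F_lt_X => ->; rewrite ltnn.
  have F_neq_M : F != M by apply: contraTneq F_lt_M => ->; rewrite ltnn.
  have oX_neq0 : orient F M X != 0.
    by apply: (extreme_noncollinear g) => //; apply/g_hull.
  have /strip/andP[Xy0 Xyh] := Hg _ Xg.
  have oX_gt0 : 0 < orient F M X.
    rewrite lt_neqAle eq_sym oX_neq0 /orient Fy My !subr0 /=.
    have leF := X_max _ (Hg _ Fg); have leM := X_max _ (Hg _ Mg).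
    have Xyh' : 0 <= h - X.2 by lra.
    have [al0|al_neq0] := eqVneq al 0.
      (* A vertical normal puts the vertices W, X and M on the top line. *)
      have Xy : X.2 = h.
        move: leM; rewrite al0 !mul0r !subr0 My (ler_pM2l be_gt0) => hX.
        by apply/eqP; rewrite eq_le Xyh.
      have Wy : W.2 = h.
        move: WX; rewrite !dotE al0 !mul0r !subr0 Xy.
        exact/mulfI/lt0r_neq0.
      have W_neq_M : W != M.
        by apply: contraTneq (ltn_trans W_lt_F F_lt_M) => ->; rewrite ltnn.
      have : orient W X M != 0.
        apply: (extreme_noncollinear g) => //; [exact/g_hull|exact/g_hull| |];
          by rewrite eq_sym.
      by rewrite /orient Wy Xy My !subrr mulr0 mul0r subrr eqxx.
    have al_gt0 : 0 < al by rewrite lt_neqAle eq_sym al_neq0.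
    rewrite -(pmulr_rge0 _ al_gt0).
    move: leF leM; rewrite Fy My mulr0 sub0r => leF leM.
    (* Comparison with F and with M bounds X.1 from above; weighted by h - X.2
       and X.2, the bounds combine to the abscissa of the line FM at height
       X.2. *)
    have := ler_wpM2l Xyh' leF; have := ler_wpM2l Xy0 leM; nra.
  have oT_lt0 : orient F M T < 0.
    rewrite /orient Fy Ty My !subr0 mulr0 sub0r oppr_lt0.
    by rewrite mulr_gt0 ?subr_gt0.
  apply: (later_vertices_same_side g (index F g) (index M g) (index T g)
    (index X g)) => //; first by rewrite index_mem.
  by rewrite /vtx !nth_index // nmulr_rlt0.
exists n; split; [|exact: WX_edge| |by rewrite WF FX XT].
- by split; [exists n|exact: prec_not_traversed WF FX].
- by split; [by case: WX_edge => _ []|exists (1 - t), t].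
Qed.

End Orientation.

Theorem corollary4p9 (R : realType) (g : seq (R * R)) (F T M Z2 : R * R) (h : R)
  (g_nonconvex : nonconvex_path g)
  (g_minimizer : escape_minimizer g)
  (g_short : plength g < Dlen)
  (FT_selected : selected_gap g F T M h)
  (Z2_contact : contact g zetaL Z2)
  (Z2_F_M : prec g Z2 F && prec g F M) :
  exists W X : R * R,
    left_delimiter_gap g W X /\ [&& prec g W F, prec g F X & prec g X T].
Proof.
have [[FT_gap M_vertex h_gt0]] := FT_selected.
move=> [strip heights FT_x /andP[FM MT] _].
have [Z2F _] := andP Z2_F_M.
have FT_neq : F != T by have [[n [[_ _ ?] _]] _] := FT_gap.
have [W [X [n [WX_gap WX_normal n_fan WFXT]]]] :=
  left_gap_between_F_and_T g F T M Z2 h rho kappa g_nonconvex.1 FT_neq M_vertex h_gt0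
    strip heights FT_x rho_gt0 kappa_gt0 Z2_contact Z2F FM MT.
by exists W, X; split=> //; split=> //; exists n.
Qed.
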